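(* Let $(X,r)$ be a finite non-degenerate solution with $|X|>1$ which is not a Lyubashenko solution. Then $(X,r)$ is simple if and only if $(X,r)$ is irretractable, the ideal $\mathcal{D}$ is the smallest non-zero ideal of the skew left brace $\mathcal{G}$ (i.e. it is non-zero and contained in every non-zero ideal of $\mathcal{G}$), and the group $(\mathbb{D},\circ)$ acts transitively on $X$ via $(\sigma_a,\gamma_b)\cdot x=\sigma_a\lambda_b(x)$.
   Context: A set-theoretic solution $(X,r)$: $X$ non-empty, $r$ satisfies $(r\times\mathrm{id})(\mathrm{id}\times r)(r\times\mathrm{id})=(\mathrm{id}\times r)(r\times\mathrm{id})(\mathrm{id}\times r)$; write $r(x,y)=(\lambda_x(y),\rho_y(x))$; non-degenerate means $r$ bijective and all $\lambda_x,\rho_y$ bijective. A morphism $f\colon(X,r)\to(Y,s)$ satisfies $(f\times f)r=s(f\times f)$; $(X,r)$ with $|X|>1$ is simple if every surjective morphism $(X,r)\to(Y,s)$ is bijective or has $|Y|=1$. Lyubashenko: $\lambda_x=\lambda_y$ and $\rho_x=\rho_y$ for all $x,y\in X$. Irretractable: $x\mapsto(\lambda_x,\rho_x)$ injective on $X$. Put $\sigma_y(x)=\lambda_y\rho_{\lambda_x^{-1}(y)}(x)$. Let $A$ be the monoid $\langle X\mid x+y=y+\sigma_y(x)\rangle$, identified (via a known bijection fixing $X$) with $M=\langle X\mid x\circ y=\lambda_x(y)\circ\rho_y(x)\rangle$, so $A$ has operations $+,\circ$ and maps $a\mapsto\lambda_a$ (monoid morphism $(A,\circ)\to\mathrm{Aut}(A,+)$),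 $a\mapsto\rho_a$, $a\mapsto\sigma_a$ (anti-morphism $(A,+)\to\mathrm{Aut}(A,+)$) extending those on $X$ and leaving $X$ invariant, with $a\circ b=a+\lambda_a(b)$, $a+b=b+\sigma_b(a)$. Let $\gamma_a=(\sigma_a^{-1},\lambda_a)$ and $\mathcal{G}=\{\gamma_a:a\in A\}$, the skew left brace with $\gamma_a+\gamma_b=\gamma_{a+b}$, $\gamma_a\circ\gamma_b=\gamma_{a\circ b}$. Let $\mathcal{C}=\{\sigma_a:a\in A\}$ (group under composition, trivial skew left brace), and $\mathcal{S}=\mathcal{C}\rtimes\mathcal{G}$ the skew left brace of pairs $(\sigma_a,\gamma_b)$ with componentwise addition and $(\sigma_a,\gamma_b)\circ(\sigma_c,\gamma_d)=(\sigma_a\sigma_{\lambda_b(c)},\gamma_{b\circ d})$. $\mathcal{D}$ is the additive subgroup of $\mathcal{G}$ generated by $\{\gamma_x-\gamma_y:x,y\in X\}$ (an ideal of $\mathcal{G}$), $\mathcal{D}'$ the subgroup of $\mathcal{C}$ generated by $\{\sigma_x\sigma_y^{-1}:x,y\in X\}$, and $\mathbb{D}=\{(d',d):d'\in\mathcal{D}',d\in\mathcal{D}\}\subseteq\mathcal{S}$ (an ideal of $\mathcal{S}$). In a skew left brace an ideal is a normal subgroup $I$ of $(B,+)$, invariant under all $\lambda_a(b)=-a+a\circ b$, and normal in $(B,\circ)$. *)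

(* Defs.v *)
From mathcomp Require Import all_boot all_fingroup.
Set Implicit Arguments. Unset Strict Implicit. Unset Printing Implicit Defensive.
Local Open Scope group_scope.

Definition r_left {Y : Type} (s : Y * Y -> Y * Y) (t : Y * Y * Y) : Y * Y * Y :=
  let '(x, y, z) := t in let '(a, b) := s (x, y) in (a, b, z).
Definition r_right {Y : Type} (s : Y * Y -> Y * Y) (t : Y * Y * Y) : Y * Y * Y :=
  let '(x, y, z) := t in let '(b, c) := s (y, z) in (x, b, c).
Definition braided {Y : Type} (s : Y * Y -> Y * Y) : Prop :=
  forall t, r_left s (r_right s (r_left s t)) = r_right s (r_left s (r_right s t)).
Definition is_solution {Y : Type} (s : Y * Y -> Y * Y) : Prop :=
  (exists y : Y, True) /\ braided s.
Definition sol_morphism {Y Z : Type} (r : Y * Y -> Y * Y) (s : Z * Z -> Z * Z)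
  (f : Y -> Z) : Prop :=
  forall p : Y * Y, let q := r p in (f q.1, f q.2) = s (f p.1, f p.2).

Section FinSol.
Variables (X : finType) (lam rho : X -> {perm X}).

Definition rsol (p : X * X) : X * X := (lam p.1 p.2, rho p.2 p.1).

Definition simple_sol : Prop :=
  (1 < #|X|)%N /\
  forall (Y : Type) (s : Y * Y -> Y * Y) (f : X -> Y),
    is_solution s -> (forall y, exists x, f x = y) -> sol_morphism rsol s f ->
    bijective f \/ (forall y y' : Y, y = y').

Definition lyubashenko : Prop := forall x y, lam x = lam y /\ rho x = rho y.
Definition irretractable : Prop := injective (fun x => (lam x, rho x)).

(* the permutation of X built from f (identity if f is not injective;
   for non-degenerate solutions sigma_y is always bijective) *)
Definition mkperm (f : X -> X) : {perm X} :=
  match injectiveb f as b return injectiveb f = b -> {perm X} with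
  | true => fun H => perm (elimT (injectiveP f) H)
  | false => fun _ => 1
  end erefl.

Definition sigma (y : X) : {perm X} :=
  mkperm (fun x => lam y (rho ((lam x)^-1 y) x)).

(* An element a = y1 + ... + yk of A is represented by the word [:: y1; ...; yk].
   All maps below are the restrictions to X (which determine them). *)
(* sigma_a, using sigma_{a+y} = sigma_y sigma_a (mathcomp: (s*t) x = t (s x)) *)
Definition Sig (w : seq X) : {perm X} := foldl (fun (acc : {perm X}) y => acc * sigma y) 1 w.
(* lambda_a, using lambda_{a+y} = lambda_a lambda_{lambda_a^{-1}(y)} *)
Definition Lam (w : seq X) : {perm X} :=
  foldl (fun (acc : {perm X}) y => lam (acc^-1 y) * acc) 1 w.
Definition gam (w : seq X) : {perm X} * {perm X} := ((Sig w)^-1, Lam w).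
Definition wcirc (u v : seq X) : seq X := u ++ map (Lam u) v.

Definition inG (g : {perm X} * {perm X}) : Prop := exists w, gam w = g.

(* additive subgroup of (G,+): gamma_u + gamma_v = gamma_{u ++ v}, 0 = gamma_[::] *)
Definition add_subgroup (H : {perm X} * {perm X} -> Prop) : Prop :=
  (forall g, H g -> inG g) /\ H (gam [::]) /\
  (forall u v, H (gam u) -> H (gam v) -> H (gam (u ++ v))) /\
  (forall u v, H (gam u) -> gam (u ++ v) = gam [::] -> H (gam v)).

(* the additive subgroup D generated by { gamma_x - gamma_y } *)
Definition contains_D_gens (H : {perm X} * {perm X} -> Prop) : Prop :=
  forall x y v, gam (v ++ [:: y]) = gam [::] -> H (gam (x :: v)).
Definition Dset (g : {perm X} * {perm X}) : Prop :=
  forall H, add_subgroup H -> contains_D_gens H -> H g.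

Definition ideal (I : {perm X} * {perm X} -> Prop) : Prop :=
  add_subgroup I /\
  (* normal in (G,+): -a + b + a in I *)
  (forall a b v, I (gam b) -> gam (v ++ a) = gam [::] -> I (gam (v ++ b ++ a))) /\
  (* lambda-invariant: -a + a o b in I *)
  (forall a b v, I (gam b) -> gam (v ++ a) = gam [::] -> I (gam (v ++ wcirc a b))) /\
  (* normal in (G,o): abar o b o a in I where abar o a = 1 *)
  (forall a b abar, I (gam b) -> gam (wcirc abar a) = gam [::] ->
     I (gam (wcirc abar (wcirc b a)))).

Definition nonzero (I : {perm X} * {perm X} -> Prop) : Prop :=
  exists g, I g /\ g <> gam [::].

Definition Dprime : {set {perm X}} :=
  <<[set (sigma y)^-1 * sigma x | x : X, y : X]>>.

Definition DD_transitive : Prop :=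
  forall x y : X, exists s, exists w,
    s \in Dprime /\ Dset (gam w) /\ s (Lam w x) = y.

End FinSol.

(* Main.v *)
Require Import Defs.
From mathcomp Require Import all_boot all_fingroup.
From mathcomp Require Import cyclic boolp.

(** For a congruence [f : X -> Y], call words [f]-equal when they act on [Y] by
    the same [lambda] and [sigma]; this is compatible with [+] and [o], so
    [{ g_w | w is f-equal to 0 }] is an ideal. If it is zero, [f x = f y] forces
    [g_x = g_y], and irretractability makes [f] injective; if not, it contains
    [D], so the group of pairs [(d', d)] acts trivially on [Y], which is then a
    point by transitivity.
    Conversely, an ideal [I] gives the congruence [g_x - g_y \in I]. When it is
    total, [I] contains [D]; when it is equality, every element of [I] acts
    trivially on [X], so [I] is zero. Likewise the orbits of the group of pairs
    form a congruence, and singleton orbits would make [g_x] independent of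
    [x], i.e. the solution Lyubashenko. *)

Set Implicit Arguments. Unset Strict Implicit. Unset Printing Implicit Defensive.
Local Open Scope group_scope.

Lemma invg_expg_card (gT : finGroupType) (x : gT) : x ^+ #|gT|.-1 = x^-1.
Proof.
apply/eqP; rewrite eq_sym eq_invg_mul -expgS prednK; last by apply/card_gt0P; exists x.
by rewrite -cardsT (expg_cardG (in_setT x)).
Qed.

Section Solution.

Variables (X : finType) (lam rho : X -> {perm X}).
Hypotheses (braid : braided (rsol lam rho)) (rsol_inj : injective (rsol lam rho)).

Local Notation sg := (sigma lam rho).
Local Notation Lm := (Lam lam).
Local Notation Sg := (Sig lam rho).
Local Notation gm := (gam lam rho).
Local Notation circ := (wcirc lam).

(** * The braid equations and the rack structure given by [sigma] *)

Lemma braidE x y z :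
  [/\ lam x (lam y z) = lam (lam x y) (lam (rho y x) z),
      rho (lam (rho y x) z) (lam x y) = lam (rho (lam y z) x) (rho z y)
    & rho z (rho y x) = rho (rho z y) (rho (lam y z) x)].
Proof. by case: (braid (x, y, z)) => /= -> -> ->. Qed.

(** Two points [a], [b] with the same value would give pairs [(a, (lam a)^-1 y)] and
    [(b, (lam b)^-1 y)] with the same image under the injective [rsol]; so [mkperm] never falls back
    to its default, the identity. *)
Lemma sigmaE y x : sg y x = lam y (rho ((lam x)^-1 y) x).
Proof.
have inj : injective (fun x => lam y (rho ((lam x)^-1 y) x)).
  move=> a b /perm_inj eq_rho.
  have /rsol_inj[] // : rsol lam rho (a, (lam a)^-1 y) = rsol lam rho (b, (lam b)^-1 y).
  by rewrite /rsol /= !permKV eq_rho.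
rewrite /sigma /mkperm; move: (erefl _).
case: {2 3}(injectiveb _) => H; first by rewrite permE.
by move/injectiveP: inj; rewrite H.
Qed.

Lemma sigma_lam x y : sg (lam x y) x = lam (lam x y) (rho y x).
Proof. by rewrite sigmaE permK. Qed.

Lemma lamJ z y x : lam z (sg y x) = sg (lam z y) (lam z x).
Proof.
rewrite -(permKV (lam x) y); move: (_ y) => t.
have [B1 B2 _] := braidE z x t.
rewrite B1 !sigma_lam B2 -B1.
by have [-> _ _] := braidE z (lam x t) (rho t x).
Qed.

(** Substituting [y = lam x s] and [z = lam x (lam s t)] removes all inverses; [lamJ] then reduces
    the two sides to the third braid equation. *)
Lemma sigmaJ z y x : sg z (sg y x) = sg (sg z y) (sg z x).
Proof.
rewrite -(permKV (lam x) y); move: (_ y) => s.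
rewrite -(permKV (lam x) z); move: (_ z) => z1.
rewrite -(permKV (lam s) z1); move: (_ z1) => t.
have [B1 B2 B3] := braidE x s t.
have [B4 _ _] := braidE (lam x s) (lam (rho s x) t) (rho t (rho s x)).
have [B5 _ _] := braidE x (lam s t) (rho t s).
rewrite sigma_lam [in LHS]B1 -lamJ sigma_lam B4 -B1 B2.
by rewrite -lamJ sigma_lam B5 sigma_lam -lamJ sigma_lam B3.
Qed.

(** Automorphisms of the rack defined by [sigma], phrased by conjugation so that they apply directly
    to products [Sg u]. *)
Definition sigma_aut (p : {perm X}) := forall y, sg (p y) = sg y ^ p.

Lemma sigma_autP (p : {perm X}) :
  (forall y x, p (sg y x) = sg (p y) (p x)) -> sigma_aut p.
Proof.
move=> pJ y; apply/permP=> x.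
by rewrite -[x in LHS](permKV p) -pJ !permM.
Qed.

Lemma sigma_autM p q : sigma_aut p -> sigma_aut q -> sigma_aut (p * q).
Proof. by move=> Hp Hq y; rewrite permM Hq Hp conjgM. Qed.

Lemma sigma_autV p : sigma_aut p -> sigma_aut p^-1.
Proof. by move=> Hp y; rewrite -{2}(permKV p y) Hp conjgK. Qed.

Lemma sigma_aut1 : sigma_aut 1.
Proof. by move=> y; rewrite perm1 conjg1. Qed.

(** * The maps attached to words, and the defining relation of A *)

Lemma Lam_nil : Lm [::] = 1. Proof. by []. Qed.
Lemma Sig_nil : Sg [::] = 1. Proof. by []. Qed.

Lemma Lam_rcons u x : Lm (rcons u x) = lam ((Lm u)^-1 x) * Lm u.
Proof. by rewrite /Lam -cats1 foldl_cat. Qed.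

Lemma Sig_rcons u x : Sg (rcons u x) = Sg u * sg x.
Proof. by rewrite /Sig -cats1 foldl_cat. Qed.

Lemma Lam1 x : Lm [:: x] = lam x.
Proof. by rewrite (Lam_rcons [::]) Lam_nil invg1 perm1 mulg1. Qed.

Lemma Sig1 x : Sg [:: x] = sg x.
Proof. by rewrite (Sig_rcons [::]) mul1g. Qed.

Lemma Lam_cat u v : Lm (u ++ v) = Lm (map (Lm u)^-1 v) * Lm u.
Proof.
elim/last_ind: v => [|v x IHv]; first by rewrite cats0 mul1g.
by rewrite -rcons_cat map_rcons !Lam_rcons IHv invMg permM mulgA.
Qed.

Lemma Sig_cat u v : Sg (u ++ v) = Sg u * Sg v.
Proof.
elim/last_ind: v => [|v x IHv]; first by rewrite cats0 mulg1.
by rewrite -rcons_cat !Sig_rcons IHv mulgA.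
Qed.

Lemma lam_aut x : sigma_aut (lam x).
Proof. by apply: sigma_autP => y z; rewrite lamJ. Qed.

Lemma sg_aut x : sigma_aut (sg x).
Proof. by apply: sigma_autP => y z; rewrite sigmaJ. Qed.

Lemma Lam_aut u : sigma_aut (Lm u).
Proof.
elim/last_ind: u => [|u x IHu]; first exact: sigma_aut1.
by rewrite Lam_rcons; apply: sigma_autM => //; apply: lam_aut.
Qed.

Lemma Sig_aut u : sigma_aut (Sg u).
Proof.
elim/last_ind: u => [|u x IHu]; first exact: sigma_aut1.
by rewrite Sig_rcons; apply: sigma_autM => //; apply: sg_aut.
Qed.

Lemma Sig_map p u : sigma_aut p -> Sg (map p u) = Sg u ^ p.
Proof.
move=> pA; elim/last_ind: u => [|u x IHu]; first by rewrite conj1g.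
by rewrite map_rcons !Sig_rcons conjMg IHu pA.
Qed.

(** This is the relation x + y = y + σ_y(x). The prefix is absorbed because [(Lm p)^-1] is a rack
    automorphism; with [y = lam x t] what remains is the first braid equation. *)
Lemma Lam_swap2 p x y w : Lm (p ++ x :: y :: w) = Lm (p ++ y :: sg y x :: w).
Proof.
rewrite !(Lam_cat p) /=; congr (_ * _).
have -> : (Lm p)^-1 (sg y x) = sg ((Lm p)^-1 y) ((Lm p)^-1 x).
  by rewrite (sigma_autV (Lam_aut p)) conjgE invgK !permM permKV.
move: ((Lm p)^-1 x) ((Lm p)^-1 y) (map _ w) => {}x {}y {}w.
rewrite -[x :: y :: w]/([:: x; y] ++ w) -[y :: _ :: w]/([:: y; sg y x] ++ w).
have eq2 : Lm [:: x; y] = Lm [:: y; sg y x].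
  rewrite (Lam_cat [:: x]) (Lam_cat [:: y] [:: _]) /= !Lam1.
  rewrite -(permKV (lam x) y); move: (_ y) => t.
  rewrite sigma_lam !permK; apply/permP=> z; rewrite !permM.
  by have [] := braidE x t z.
by rewrite (Lam_cat [:: x; y]) (Lam_cat [:: y; sg y x]) eq2.
Qed.

Lemma Lam_swap1 v p x w : Lm (p ++ x :: v ++ w) = Lm (p ++ v ++ Sg v x :: w).
Proof.
elim: v p x => [|y v IHv] p x; first by rewrite Sig_nil perm1.
rewrite /= Lam_swap2 -(cat_rcons y p) IHv cat_rcons.
by rewrite -[y :: v]cat1s Sig_cat permM Sig1.
Qed.

Lemma Lam_swap u v : Lm (u ++ v) = Lm (v ++ map (Sg v) u).
Proof.
suff H w : Lm (u ++ v ++ w) = Lm (v ++ map (Sg v) u ++ w).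
  by have := H [::]; rewrite !cats0.
elim/last_ind: u w => [|u x IHu] w //.
by rewrite cat_rcons Lam_swap1 IHu map_rcons cat_rcons.
Qed.

(** The substitute for commutativity: it moves statements about a left summand to a right summand,
    and back. *)
Lemma gam_swap u v : gm (u ++ v) = gm (v ++ map (Sg v) u).
Proof.
rewrite /gam Lam_swap !Sig_cat Sig_map; last exact: Sig_aut.
by rewrite -conjgC.
Qed.

Lemma gam_eqP u v : gm u = gm v <-> Lm u = Lm v /\ Sg u = Sg v.
Proof. by rewrite /gam; split=> [[/invg_inj-> ->]|[-> ->]]. Qed.

Lemma Lam_circ u v : Lm (circ u v) = Lm v * Lm u.
Proof. by rewrite Lam_cat -map_comp map_id_in // => x _ /=; rewrite permK. Qed.

Lemma Sig_circ u v : Sg (circ u v) = Sg u * Sg v ^ Lm u.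
Proof. by rewrite Sig_cat Sig_map //; apply: Lam_aut. Qed.

(** * Congruences on X and the action of words modulo them *)

Section Congruence.

Variables (Y : Type) (f : X -> Y).

Definition pres (p : {perm X}) := forall x y, f x = f y -> f (p x) = f (p y).
Definition peq (p q : {perm X}) := forall x, f (p x) = f (q x).

Lemma presM p q : pres p -> pres q -> pres (p * q).
Proof. by move=> Hp Hq x y /Hp/Hq; rewrite !permM. Qed.

(** Since X is finite, the inverse is a positive power of [p]. *)
Lemma presV p : pres p -> pres p^-1.
Proof.
move=> Hp; rewrite invg_expg; elim: _.-1 => [|n IHn]; first by move=> x y; rewrite !perm1.
by rewrite expgS; apply: presM.
Qed.

Lemma peqM p p' q q' : pres q -> peq p p' -> peq q q' -> peq (p * q) (p' * q').
Proof. by move=> Hq Hp Hqq x; rewrite !permM -Hqq; apply: Hq. Qed.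

Lemma peqV p q : pres p -> peq p q -> peq p^-1 q^-1.
Proof.
move=> Hp Hpq x; rewrite -[q^-1 x](permK p).
by apply: (presV Hp); rewrite Hpq permKV.
Qed.

(** Stated with λ and σ instead of λ and ρ, because these are the maps that extend to words;
    [congr_homo] and [rho_congr] translate between the two forms. *)
Definition ls_congr :=
  (forall x, pres (lam x)) /\ (forall x, pres (sg x)) /\
  (forall x y, f x = f y -> peq (lam x) (lam y) /\ peq (sg x) (sg y)).

Hypothesis cf : ls_congr.

Lemma pres_Lam u : pres (Lm u).
Proof.
elim/last_ind: u => [|u x IHu]; first by move=> x y; rewrite !perm1.
by rewrite Lam_rcons; apply: presM => //; apply: cf.1.
Qed.

Lemma pres_Sig u : pres (Sg u).
Proof.
elim/last_ind: u => [|u x IHu]; first by move=> x y; rewrite !perm1.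
by rewrite Sig_rcons; apply: presM => //; apply: cf.2.1.
Qed.

Definition geq u v := peq (Lm u) (Lm v) /\ peq (Sg u) (Sg v).

Lemma geq_gam u v : gm u = gm v -> geq u v.
Proof. by move/gam_eqP=> [Hl Hs]; split=> x; rewrite ?Hl ?Hs. Qed.

Lemma geq_sym u v : geq u v -> geq v u.
Proof. by move=> [Hl Hs]; split=> x. Qed.

Lemma geq_trans v u w : geq u v -> geq v w -> geq u w.
Proof. by move=> [Hl Hs] [Hl' Hs']; split=> x; rewrite ?Hl ?Hs. Qed.

Lemma geq_map u v : map f u = map f v -> geq u v.
Proof.
elim/last_ind: u v => [|u x IHu] v; elim/last_ind: v => [|v y _] //.
- by rewrite map_rcons => /(congr1 size); rewrite size_rcons.
- by rewrite map_rcons => /(congr1 size); rewrite size_rcons.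
rewrite !map_rcons => /rcons_inj[/IHu[Hl Hs] eqxy].
rewrite /geq !Lam_rcons !Sig_rcons; split; apply: peqM => //.
- exact: pres_Lam.
- apply: (cf.2.2 _ _ _).1.
  rewrite (presV (@pres_Lam u) eqxy); exact: peqV (@pres_Lam u) Hl y.
- exact: cf.2.1.
- by have [] := cf.2.2 _ _ eqxy.
Qed.

Lemma map_peq p q u : peq p q -> map f (map p u) = map f (map q u).
Proof. by move=> Hpq; rewrite -!map_comp; apply: eq_map => x /=; apply: Hpq. Qed.

Lemma geq_catl u u' v : geq u u' -> geq (u ++ v) (u' ++ v).
Proof.
move=> [Hl Hs]; rewrite /geq !Lam_cat !Sig_cat; split; apply: peqM => //.
- exact: pres_Lam.
- by have [] := geq_map (map_peq v (peqV (@pres_Lam u) Hl)).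
- exact: pres_Sig.
Qed.

(** [gam_swap] rewrites u + v as v + σ_v(u), so the change of [v] happens on the left, and in σ_v,
    where it changes the letters of [u] only within their classes. *)
Lemma geq_catr u v v' : geq v v' -> geq (u ++ v) (u ++ v').
Proof.
move=> Hv; have [Hl Hs] := Hv.
apply: geq_trans (geq_gam (gam_swap u v)) _.
apply: geq_trans (geq_sym (geq_gam (gam_swap u v'))).
apply: geq_trans (geq_catl _ Hv) _.
rewrite /geq !Lam_cat !Sig_cat.
have [Hl' Hs'] := geq_map (map_peq u Hs).
split; apply: peqM => //; [exact: pres_Lam | | exact: pres_Sig].
rewrite -!map_comp.
suff /geq_map[] : map f (map ((Lm v')^-1 \o Sg v) u) = map f (map ((Lm v')^-1 \o Sg v') u) by [].
rewrite -!map_comp; apply: eq_map => x /=.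
by apply: (presV (@pres_Lam v')).
Qed.

Lemma geq_cat u u' v v' : geq u u' -> geq v v' -> geq (u ++ v) (u' ++ v').
Proof. by move=> Hu Hv; apply: geq_trans (geq_catl _ Hu) (geq_catr _ Hv). Qed.

Lemma geq_circ u u' v v' : geq u u' -> geq v v' -> geq (circ u v) (circ u' v').
Proof.
move=> [Hl Hs] [Hl' Hs']; rewrite /geq !Lam_circ !Sig_circ !conjgE.
have Pl := pres_Lam; have Ps := pres_Sig.
split; first exact: peqM.
apply: peqM => //; first exact: presM (presV (Pl u)) (presM (Ps v) (Pl u)).
exact: peqM (presM (Ps v) (Pl u)) (peqV (Pl u) Hl) (peqM (Pl u) Hs' Hl).
Qed.

End Congruence.

(** * The skew left brace G as words modulo [gam] *)

Lemma gam_geq u v : gm u = gm v <-> geq id u v.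
Proof.
rewrite gam_eqP; split=> -[Hl Hs]; first by split=> x; rewrite ?Hl ?Hs.
by split; apply/permP.
Qed.

Lemma ls_congr_id : ls_congr id.
Proof. by split; [|split] => x y; [move=> z ->|move=> z ->|move=> /= ->]. Qed.

(** Equality in G is [geq] for the identity map, so addition is well defined on G by the results on
    congruences. *)
Lemma gam_cat u u' v v' : gm u = gm u' -> gm v = gm v' -> gm (u ++ v) = gm (u' ++ v').
Proof. by rewrite !gam_geq; apply: (geq_cat ls_congr_id). Qed.

Lemma gam_circ u u' v v' : gm u = gm u' -> gm v = gm v' -> gm (circ u v) = gm (circ u' v').
Proof. by rewrite !gam_geq; apply: (geq_circ ls_congr_id). Qed.

(* The pair (Lam, tau) turns the circle operation into (op-)multiplication of
   permutations, so circle inverses are circle powers. *)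
Definition tau u := Sg u * (Lm u)^-1.

Lemma tau_circ u v : tau (circ u v) = tau u * tau v.
Proof. by rewrite /tau Sig_circ Lam_circ conjgE invMg !mulgA !mulgK. Qed.

Lemma gam_eq0 u : Lm u = 1 -> tau u = 1 -> gm u = gm [::].
Proof. by move=> Hl; rewrite /tau Hl invg1 mulg1 => Hs; apply/gam_eqP. Qed.

Definition cinv u := iter #|{perm X}|.-1 (circ u) [::].

Lemma Lam_cinv u : Lm (cinv u) = (Lm u)^-1.
Proof.
have -> : Lm (cinv u) = Lm u ^+ #|{perm X}|.-1.
  by rewrite /cinv; elim: _.-1 => //= n IHn; rewrite Lam_circ IHn expgSr.
exact: invg_expg_card.
Qed.

Lemma tau_cinv u : tau (cinv u) = (tau u)^-1.
Proof.
have -> : tau (cinv u) = tau u ^+ #|{perm X}|.-1.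
  rewrite /cinv; elim: _.-1 => [|n IHn] /=; first by rewrite /tau mul1g invg1.
  by rewrite tau_circ IHn expgS.
exact: invg_expg_card.
Qed.

Lemma circ_cinvr u : gm (circ u (cinv u)) = gm [::].
Proof. by apply: gam_eq0; rewrite ?Lam_circ ?tau_circ ?Lam_cinv ?tau_cinv ?mulVg ?mulgV. Qed.

Lemma circ_cinvl u : gm (circ (cinv u) u) = gm [::].
Proof. by apply: gam_eq0; rewrite ?Lam_circ ?tau_circ ?Lam_cinv ?tau_cinv ?mulVg ?mulgV. Qed.

(** The additive inverse, read off from 0 = u ∘ ū = u + λ_u(ū), where ū is the circle inverse. *)
Definition aneg u := map (Lm u) (cinv u).

Lemma gam_addrN u : gm (u ++ aneg u) = gm [::]. Proof. exact: circ_cinvr. Qed.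

Lemma gam_negC u v : gm (u ++ v) = gm [::] -> gm (v ++ u) = gm [::].
Proof.
(* By [gam_swap], v' + u = u + v = 0, so [v'] is a left inverse of [u]; then v = v' + u + v = v'. *)
move=> uv0; pose v' := map (Sg u)^-1 v.
have v'u0 : gm (v' ++ u) = gm [::].
  rewrite gam_swap /v' -map_comp map_id_in // => x _ /=.
  by rewrite permKV.
rewrite -{}v'u0; apply: gam_cat => //.
transitivity (gm (v' ++ (u ++ v))); last by rewrite -[v' in RHS]cats0; apply: gam_cat.
rewrite catA; apply: (@gam_cat [::]) => //; symmetry.
rewrite gam_swap /v' -map_comp map_id_in // => x _ /=.
by rewrite permKV.
Qed.

Lemma gam_addNr u : gm (aneg u ++ u) = gm [::].
Proof. exact/gam_negC/gam_addrN. Qed.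

Lemma gam_cancel u v v' : gm (u ++ v) = gm (u ++ v') -> gm v = gm v'.
Proof.
move=> Huv.
have H w : gm (aneg u ++ (u ++ w)) = gm w.
  by rewrite catA -[w in RHS]cat0s; apply: gam_cat => //; apply: gam_addNr.
by rewrite -(H v) -(H v'); apply: gam_cat.
Qed.

Lemma gam_map_Lam a u v : gm u = gm v -> gm (map (Lm a) u) = gm (map (Lm a) v).
Proof. by move=> Huv; apply: (@gam_cancel a); apply: (@gam_circ a a). Qed.

Lemma gam_zero_cat u v : gm u = gm [::] -> gm (u ++ v) = gm v.
Proof. by move=> u0; rewrite -[v in RHS]cat0s; apply: gam_cat. Qed.

Lemma gam_cat_zero u v : gm v = gm [::] -> gm (u ++ v) = gm u.
Proof. by move=> v0; rewrite -[u in RHS]cats0; apply: gam_cat. Qed.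

(** ρ is recovered from λ and σ: by [sigma_lam], [rho x z] is determined by σ and λ of the letter
    [lam z x], and [lam z x] and [lam z y] are again equal in G. *)
Lemma gam1_lam_rho x y : gm [:: x] = gm [:: y] -> lam x = lam y /\ rho x = rho y.
Proof.
move=> Hxy; have lamxy : lam x = lam y by move/gam_eqP: Hxy; rewrite !Lam1 => -[].
split=> //; apply/permP=> z.
have : gm [:: lam z x] = gm [:: lam z y].
  by have := gam_map_Lam [:: z] Hxy; rewrite Lam1.
move/gam_eqP; rewrite !Lam1 !Sig1 => -[_ /permP/(_ z)].
rewrite !sigma_lam.
have /gam_eqP[] : gm [:: lam z x] = gm [:: lam z y].
  by have := gam_map_Lam [:: z] Hxy; rewrite Lam1.
by rewrite !Lam1 => -> _ /perm_inj.
Qed.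

(** * Congruences and quotient solutions *)

Lemma congr_homo (Y : Type) (f : X -> Y) :
  (forall x y, f x = f y -> forall z, f (lam z x) = f (lam z y) /\ f (lam x z) = f (lam y z)) ->
  (forall x y, f x = f y -> forall z, f (rho z x) = f (rho z y) /\ f (rho x z) = f (rho y z)) ->
  ls_congr f.
Proof.
move=> Hl Hr.
have Pl x : pres f (lam x) by move=> y z /Hl/(_ x)[].
have Pr x : pres f (rho x) by move=> y z /Hr/(_ x)[].
have Ql x y : f x = f y -> peq f (lam x) (lam y) by move=> /Hl H z; have [] := H z.
have Qr x y : f x = f y -> peq f (rho x) (rho y) by move=> /Hr H z; have [] := H z.
split=> //; split=> [x y z eqyz|x y eqxy].
  rewrite !sigmaE; apply: (Pl); rewrite (Pr _ _ _ eqyz); apply: Qr.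
  exact: (peqV (Pl y) (Ql _ _ eqyz)).
split=> [|z]; first exact: Ql.
rewrite !sigmaE (Ql _ _ eqxy); apply: (Pl); apply: Qr.
exact: (presV (Pl z)).
Qed.

Lemma rho_congr (Y : Type) (f : X -> Y) : ls_congr f ->
  forall x y, f x = f y -> forall z, f (rho z x) = f (rho z y) /\ f (rho x z) = f (rho y z).
Proof.
move=> [Pl [Ps Q]] x y eqxy z.
have E u v : rho v u = (lam (lam u v))^-1 (sg (lam u v) u) by rewrite sigma_lam permK.
have Hx : f (lam x z) = f (lam y z) by have [] := Q _ _ eqxy.
have Hz : f (lam z x) = f (lam z y) by apply: Pl.
have V u v : f u = f v -> peq f (lam u)^-1 (lam v)^-1.
  by move=> /Q[Huv _]; apply: (peqV (Pl u)).
split; rewrite !E.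
  rewrite (V _ _ Hx); apply: (presV (Pl _)).
  by rewrite (Ps _ _ _ eqxy); have [] := Q _ _ Hx.
by rewrite (V _ _ Hz); apply: (presV (Pl _)); have [] := Q _ _ Hz.
Qed.

(** The form in which simplicity is applied: the image of a congruence carries a solution for which
    the corestriction of [f] is a surjective morphism. *)
Lemma simple_dichotomy (Y : eqType) (f : X -> Y) : simple_sol lam rho ->
  ls_congr f -> injective f \/ forall x y, f x = f y.
Proof.
move=> [cardX simpleX] cf; have [Pl [Ps Q]] := cf.
pose g x : {y | y \in codom f} := exist _ (f x) (codom_f f x).
have gE x y : g x = g y <-> f x = f y.
  by split=> [[]//|eqxy]; apply: val_inj.
(* A representative of each class; [sE] shows that [s] does not depend on this choice. *)
pose r (y : {y | y \in codom f}) := iinv (valP y).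
have rK y : g (r y) = y by apply: val_inj; rewrite /= f_iinv.
have grK x : f (r (g x)) = f x by apply/gE.
pose s (p : {y | y \in codom f} * {y | y \in codom f}) :=
  (g (lam (r p.1) (r p.2)), g (rho (r p.2) (r p.1))).
have sE x y : s (g x, g y) = (g (lam x y), g (rho y x)).
  have Hr := rho_congr cf.
  congr (_, _); apply/gE => /=; have [Hx Hy] := (grK x, grK y).
    by rewrite (Pl _ _ _ Hy); have [] := Q _ _ Hx.
  by have [-> _] := Hr _ _ Hx (r (g y)); have [] := Hr _ _ Hy x.
have /card_gt0P[x0 _] := ltnW cardX.
case: (simpleX _ s g) => [|y|[x y]|[h gK _]|H].
- split; first by exists (g x0).
  move=> [[y1 y2] y3]; rewrite -(rK y1) -(rK y2) -(rK y3).
  move: (r y1) (r y2) (r y3) => x1 x2 x3.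
  have [B1 B2 B3] := braidE x1 x2 x3.
  by rewrite /r_left /r_right !sE !(B1, B2, B3).
- by exists (r y).
- by rewrite sE.
- by left=> x y /gE eqxy; rewrite -(gK x) -(gK y) eqxy.
- by right=> x y; apply/gE.
Qed.

(** * The congruence defined by an ideal *)

Lemma circA a b c : circ (circ a b) c = circ a (circ b c).
Proof.
rewrite {1 3}/wcirc Lam_circ /wcirc -catA map_cat -map_comp; congr (_ ++ (_ ++ _)).
by apply: eq_map => x; rewrite permM.
Qed.

Lemma circ_nill a : circ [::] a = a.
Proof. by rewrite /wcirc /= map_id_in // => x _; rewrite perm1. Qed.

Lemma circ_nilr a : circ a [::] = a.
Proof. exact: cats0. Qed.

Section QuotientByIdeal.

Variable I : {perm X} * {perm X} -> Prop.
Hypothesis idI : ideal lam rho I.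

Local Notation J w := (I (gm w)).

Lemma ideal_gam u v : gm u = gm v -> J u -> J v. Proof. by move=> ->. Qed.

Lemma ideal_cat u v : J u -> J v -> J (u ++ v).
Proof. by case: idI => -[_ [_ [H _]]] _; apply: H. Qed.

Lemma ideal_neg u v : J u -> gm (u ++ v) = gm [::] -> J v.
Proof. by case: idI => -[_ [_ [_ H]]] _; apply: H. Qed.

Lemma ideal_conj a b v : J b -> gm (v ++ a) = gm [::] -> J (v ++ b ++ a).
Proof. by case: idI => _ [H _]; apply: H. Qed.

Lemma ideal_map a b : J b -> J (map (Lm a) b).
Proof.
case: idI => _ [_ [H _]] Jb.
apply: ideal_gam (H a b _ Jb (gam_addNr a)).
by rewrite /wcirc catA; apply: gam_zero_cat; apply: gam_addNr.
Qed.

Lemma ideal_circ_conj a b : J b -> J (circ (cinv a) (circ b a)).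
Proof. by case: idI => _ [_ [_ H]] Jb; apply: H => //; apply: circ_cinvl. Qed.

(** The relation u - v ∈ I, written additively so that no negative has to be chosen. *)
Definition imod u v := exists2 w, J w & gm u = gm (w ++ v).

Lemma imod_gam u v : gm u = gm v -> imod u v.
Proof. by exists [::] => //; case: idI => -[_ []]. Qed.

Lemma imod_trans v u w : imod u v -> imod v w -> imod u w.
Proof.
move=> [i Ji Hi] [j Jj Hj]; exists (i ++ j); first exact: ideal_cat.
by rewrite Hi -catA; apply: gam_cat.
Qed.

Lemma imod_sym u v : imod u v -> imod v u.
Proof.
move=> [i Ji Hi]; exists (aneg i).
  by apply: ideal_neg Ji _; apply: gam_addrN.
transitivity (gm (aneg i ++ (i ++ v))); last exact: gam_cat.
by rewrite catA; symmetry; apply: gam_zero_cat; apply: gam_addNr.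
Qed.

Lemma imod_catl u u' v : imod u u' -> imod (u ++ v) (u' ++ v).
Proof. by move=> [i Ji Hi]; exists i => //; rewrite catA; apply: gam_cat. Qed.

Lemma imod_catr u v v' : imod v v' -> imod (u ++ v) (u ++ v').
Proof.
(* From u + i + v' = (u + i - u) + (u + v'), with the bracket in I by normality. *)
move=> [i Ji Hi]; exists (u ++ i ++ aneg u).
  by apply: ideal_conj => //; apply: gam_addrN.
transitivity (gm (u ++ (i ++ v'))); first exact: gam_cat.
rewrite -!catA; apply: gam_cat => //; apply: gam_cat => //.
by rewrite catA; symmetry; apply: gam_zero_cat; apply: gam_addNr.
Qed.

Lemma imod_cancel u u' v v' : imod u u' -> imod (u ++ v) (u' ++ v') -> imod v v'.
Proof.
move=> /imod_sym Huu Huv.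
have H : imod (aneg u ++ (u ++ v)) (aneg u ++ (u ++ v')).
  apply/imod_catr/(imod_trans Huv).
  exact: imod_catl.
have E w : gm (aneg u ++ (u ++ w)) = gm w.
  by rewrite catA; apply: gam_zero_cat; apply: gam_addNr.
apply: imod_trans (imod_gam (esym (E v))) (imod_trans H _).
exact: imod_gam.
Qed.

Lemma imod_map a v v' : imod v v' -> imod (map (Lm a) v) (map (Lm a) v').
Proof.
move=> [i Ji Hi]; exists (map (Lm a) i); first exact: ideal_map.
by rewrite -map_cat; apply: gam_map_Lam.
Qed.

(* i + u' = u' o j and j o v = v o k with j, k in I. *)
Lemma imod_circl u u' v : imod u u' -> imod (circ u v) (circ u' v).
Proof.
move=> [i Ji Hi].
pose j := map (Lm (cinv u')) (aneg u' ++ i ++ u').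
have Jj : J j by apply/ideal_map/ideal_conj => //; apply: gam_addNr.
have Hj : gm (i ++ u') = gm (circ u' j).
  rewrite /wcirc /j -map_comp map_id_in; last first.
    by move=> x _ /=; rewrite Lam_cinv permKV.
  by rewrite catA; symmetry; apply: gam_zero_cat; apply: gam_addrN.
pose k := circ (cinv v) (circ j v).
have Jk : J k by apply: ideal_circ_conj.
pose uv := circ u' v.
have Huv : gm (circ u v) = gm (uv ++ map (Lm uv) k).
  transitivity (gm (circ (circ u' j) v)); first by apply: gam_circ => //; rewrite Hi.
  rewrite -[uv ++ _]/(circ uv k) /uv /k -!circA.
  apply: gam_circ => //; apply: gam_circ => //; rewrite circA -[u' in LHS]circ_nilr.
  by apply: gam_circ => //; symmetry; apply: circ_cinvr.
apply: imod_trans (imod_gam Huv) _.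
rewrite -[circ u' v]cats0; apply: imod_catr; exists (map (Lm uv) k).
  exact: ideal_map.
by rewrite cats0.
Qed.

Lemma imod_mapl u u' v : imod u u' -> imod (map (Lm u) v) (map (Lm u') v).
Proof. by move=> Huu; apply: imod_cancel (Huu) _; apply: imod_circl. Qed.

(** In v + u = u + σ_u(v) the left side respects the congruence, and [u] can be cancelled on the
    right side. *)
Lemma imod_Sig u u' v v' : imod u u' -> imod v v' ->
  imod (map (Sg u) v) (map (Sg u') v').
Proof.
move=> Hu Hv; apply: imod_cancel (Hu) _.
apply: imod_trans (imod_gam (esym (gam_swap _ _))) _.
apply: imod_trans (imod_gam (gam_swap _ _)).
exact: imod_trans (imod_catl _ Hv) (imod_catr _ Hu).
Qed.

(** Classes are finite sets, so the class map lands in an [eqType], as [simple_dichotomy]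
    requires. *)
Definition iclass (x : X) : {set X} := [set y | `[< imod [:: x] [:: y] >]].

Lemma iclassP x y : iclass x = iclass y <-> imod [:: x] [:: y].
Proof.
split=> [/setP/(_ y)|Hxy].
  by rewrite !inE => H; apply/asboolP; rewrite H; apply/asboolP/imod_gam.
apply/setP=> z; rewrite !inE; apply/asboolP/asboolP; apply: imod_trans => //.
exact: imod_sym.
Qed.

Lemma ls_congr_iclass : ls_congr iclass.
Proof.
have L x u : map (Lm [:: x]) u = map (lam x) u by rewrite Lam1.
have S x u : map (Sg [:: x]) u = map (sg x) u by rewrite Sig1.
split=> [x y z|]; last split=> [x y z|x y].
- by rewrite !iclassP => /(imod_map [:: x]); rewrite !L.
- by rewrite !iclassP => Hyz; have := imod_Sig (imod_gam (erefl (gm [:: x]))) Hyz; rewrite !S.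
- rewrite iclassP => Hxy; split=> z; apply/iclassP.
    by have := imod_mapl [:: z] Hxy; rewrite !L.
  by have := imod_Sig Hxy (imod_gam (erefl (gm [:: z]))); rewrite !S.
Qed.

(** An element of I is congruent to zero, so its λ and σ send every letter to one in the same class,
    here to itself. *)
Lemma ideal_zero_of_iclass_inj : injective iclass -> forall w, J w -> gm w = gm [::].
Proof.
move=> inj w Jw.
have Hw : imod w [::] by exists w => //; rewrite cats0.
apply/gam_eqP; split; apply/permP=> x; rewrite perm1; apply: inj; apply/iclassP.
  by have := imod_mapl [:: x] Hw; rewrite /= perm1.
by have := imod_Sig Hw (imod_gam (erefl (gm [:: x]))); rewrite /= perm1.
Qed.

Lemma Dset_sub_ideal : (forall x y, iclass x = iclass y) ->
  forall g, Dset lam rho g -> I g.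
Proof.
move=> Hxy g; apply; first by case: idI.
move=> x y v Hv; have [w Jw Hw] := (iclassP x y).1 (Hxy x y).
apply: ideal_gam Jw; symmetry.
transitivity (gm ((w ++ [:: y]) ++ v)); first by rewrite -cat1s; apply: gam_cat.
by rewrite -catA; apply: gam_cat_zero; apply: gam_negC.
Qed.

End QuotientByIdeal.

(** * Differences of letters and the ideal defined by a congruence *)

Lemma gam_sub_eq0 x y : gm ([:: x] ++ aneg [:: y]) = gm [::] -> gm [:: x] = gm [:: y].
Proof.
move=> xy0; transitivity (gm (([:: x] ++ aneg [:: y]) ++ [:: y])).
  by rewrite -catA; symmetry; apply: gam_cat_zero; apply: gam_addNr.
exact: gam_zero_cat.
Qed.

Lemma Dset_gen x y : Dset lam rho (gm ([:: x] ++ aneg [:: y])).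
Proof. by move=> H _; apply; apply: gam_addNr. Qed.

Section KernelIdeal.

Variables (Y : Type) (f : X -> Y).
Hypothesis cf : ls_congr f.

Definition kernel_ideal g := exists2 w, gm w = g & geq f w [::].

Lemma kernel_idealP u : kernel_ideal (gm u) <-> geq f u [::].
Proof.
split=> [[w Hw Kw]|]; last by exists u.
exact: geq_trans (geq_gam f (esym Hw)) Kw.
Qed.

Lemma geq_cat0 u v : geq f v [::] -> geq f (u ++ v) u.
Proof. by move=> Hv; rewrite -[X in geq _ _ X]cats0; apply: geq_catr. Qed.

Lemma geq_0cat u v : geq f u [::] -> geq f (u ++ v) v.
Proof. by move=> Hu; rewrite -[X in geq _ _ X]cat0s; apply: geq_catl. Qed.

Lemma ideal_kernel : ideal lam rho kernel_ideal.
Proof.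
split; [split; [|split; [|split]]|split; [|split]].
- by move=> _ [w <- _]; exists w.
- by exists [::].
- move=> u v /kernel_idealP Hu /kernel_idealP Hv; apply/kernel_idealP.
  exact: geq_trans (geq_0cat v Hu) Hv.
- move=> u v /kernel_idealP Hu Huv; apply/kernel_idealP.
  exact: geq_trans (geq_sym (geq_0cat v Hu)) (geq_gam f Huv).
- move=> a b v /kernel_idealP Hb Hva; apply/kernel_idealP.
  apply: geq_trans (geq_gam f Hva).
  by apply: geq_catr => //; apply: geq_0cat.
- move=> a b v /kernel_idealP Hb Hva; apply/kernel_idealP.
  apply: geq_trans (geq_gam f Hva); apply: geq_catr => //.
  rewrite -[X in geq _ _ X]circ_nilr.
  by apply: geq_circ => //; apply: geq_gam.
- move=> a b c /kernel_idealP Hb Hca; apply/kernel_idealP.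
  apply: geq_trans (geq_gam f Hca); apply: geq_circ => //.
  rewrite -[X in geq _ _ X]circ_nill.
  by apply: geq_circ => //; apply: geq_gam.
Qed.

Lemma kernel_trivial_inj : irretractable lam rho ->
  ~ nonzero lam rho kernel_ideal -> injective f.
Proof.
move=> irr triv x y eqxy; apply: irr.
rewrite /=; suff [-> ->] : lam x = lam y /\ rho x = rho y by [].
apply/gam1_lam_rho/gam_sub_eq0; apply: contrapT => nz; apply: triv.
exists (gm ([:: x] ++ aneg [:: y])); split=> //; apply/kernel_idealP.
apply: geq_trans (geq_gam f (gam_addrN [:: y])); apply: geq_catl => //.
by apply: geq_map => //=; rewrite eqxy.
Qed.

Lemma kernel_contains_D_const : (forall g, Dset lam rho g -> kernel_ideal g) ->
  DD_transitive lam rho -> forall x y, f x = f y.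
Proof.
move=> DK tr x y; have [s [w [Ds [Dw <-]]]] := tr x y.
have /kernel_idealP[Kw _] := DK _ Dw.
suff -> z : f (s z) = f z by rewrite Kw perm1.
(* The difference u - v lies in D and hence acts trivially modulo [f]; adding [v] compares [u] with
   [v]. *)
have sgE u v : peq f (sg u) (sg v).
  have /kernel_idealP H := DK _ (Dset_gen u v).
  have [_] : geq f [:: u] [:: v]; last by rewrite !Sig1.
  apply: geq_trans (geq_0cat [:: v] H); apply: geq_sym.
  by rewrite -catA; apply: geq_cat0; apply/geq_gam/gam_addNr.
(* The permutations that preserve every fibre of [f] form a group, so it suffices to find the
   generators of [Dprime] in it. *)
pose F := [set p : {perm X} | [forall x, `[< f (p x) = f x >]]].
have gF : group_set F.
  apply/group_setP; split=> [|p q].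
    by rewrite inE; apply/forallP=> t; apply/asboolP; rewrite perm1.
  rewrite !inE => /forallP Hp /forallP Hq; apply/forallP=> t; apply/asboolP.
  by rewrite permM (asboolP _ (Hq _)) (asboolP _ (Hp _)).
suff /subsetP/(_ s Ds) : Dprime lam rho \subset Group gF.
  by rewrite inE => /forallP/(_ z)/asboolP.
rewrite gen_subG; apply/subsetP=> _ /imset2P[u v _ _ ->].
rewrite inE; apply/forallP=> t; apply/asboolP.
by rewrite permM (sgE u v) permKV.
Qed.

End KernelIdeal.

(** * Elements of degree zero and the group of pairs acting on X *)

Definition balanced (w : seq X) := exists2 w', size w = size w' & gm w' = gm [::].

Lemma size_circ u v : size (circ u v) = size u + size v.
Proof. by rewrite size_cat size_map. Qed.

(** Length belongs to words rather than to elements of G, so degree zero means having the length of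
    some word for zero; [circ] adds lengths for both. *)
Lemma balanced_circ u v : balanced u -> balanced v -> balanced (circ u v).
Proof.
move=> [u' su u0] [v' sv v0]; exists (circ u' v'); first by rewrite !size_circ su sv.
exact: (@gam_circ _ [::] _ [::]).
Qed.

(* With a = u', the step is (u x) - (u' y) = (u - u') + (a + x - y - a), whose last
   summand is again a difference of two letters since a + x = x' + a. *)
Lemma balanced_Dset w : balanced w -> Dset lam rho (gm w).
Proof.
move=> [w' sw w'0] H aH gH.
have [_ [H0 [Hcat _]]] := aH.
suff step u u' n : size u = size u' -> gm (u' ++ n) = gm [::] -> H (gm (u ++ n)).
  by have := step w w' [::] sw; rewrite !cats0; apply.
elim/last_ind: u u' n => [|u x IHu] u' n; case/lastP: u' => [|u' y].
- by move=> _ /= ->.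
- by rewrite size_rcons.
- by rewrite size_rcons.
rewrite !size_rcons => -[su] n0.
pose m := aneg u'; pose x' := (Sg u')^-1 x; pose y' := (Sg u')^-1 y.
have swap z : gm (u' ++ [:: z]) = gm ((Sg u')^-1 z :: u').
  by rewrite -[in RHS]cat1s [in RHS]gam_swap /= permKV.
have -> : gm (rcons u x ++ n) = gm ((u ++ m) ++ (x' :: u' ++ n)).
  rewrite cat_rcons -catA; apply: gam_cat => //.
  transitivity (gm (m ++ ((u' ++ [:: x]) ++ n))).
    rewrite -[x :: n]cat1s -!catA catA; symmetry; apply: gam_zero_cat.
    exact: gam_addNr.
  by apply: gam_cat => //; rewrite -cat_cons; apply: gam_cat => //; apply: swap.
apply: Hcat; first by apply: (IHu u') => //; apply: gam_addrN.
apply: (gH x' y'); apply: gam_negC; rewrite -n0 cat1s -cat_cons.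
by rewrite -cats1; apply: gam_cat => //; rewrite swap.
Qed.

(** Serves as λ(D): balanced words lie in D by [balanced_Dset], and their closure under [circ] makes
    this set a group. *)
Definition lamD : {set {perm X}} := [set p | `[< exists2 w, balanced w & Lm w = p >]].

Lemma lamDP p : reflect (exists2 w, balanced w & Lm w = p) (p \in lamD).
Proof. by rewrite inE; apply: asboolP. Qed.

Lemma group_lamD : group_set lamD.
Proof.
apply/group_setP; split; first by apply/lamDP; exists [::] => //; exists [::].
move=> _ _ /lamDP[u bu <-] /lamDP[v bv <-]; apply/lamDP.
by exists (circ v u); [apply: balanced_circ | rewrite Lam_circ].
Qed.
Canonical lamD_group := Group group_lamD.

Lemma lam_lamD x y : (lam y)^-1 * lam x \in lamD.
Proof.
(* It has the length of y ∘ ȳ, which is zero in G. *)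
apply/lamDP; exists (circ [:: x] (cinv [:: y])).
  exists (circ [:: y] (cinv [:: y])); first by rewrite !size_circ.
  exact: circ_cinvr.
by rewrite Lam_circ Lam_cinv !Lam1.
Qed.

Lemma norm_lamD x : lam x \in 'N(lamD).
Proof.
rewrite inE; apply/subsetP=> _ /imsetP[_ /lamDP[w [w' sw w0] <-] ->].
apply/lamDP; exists (circ [:: x] (circ w (cinv [:: x]))).
  exists (circ [:: x] (circ w' (cinv [:: x]))); first by rewrite !size_circ sw.
  rewrite -(circ_cinvr [:: x]); apply: gam_circ => //.
  by rewrite -[X in _ = gm X]circ_nill; apply: gam_circ.
by rewrite !Lam_circ Lam_cinv Lam1 conjgE mulgA.
Qed.

Definition sigma_quots := [set (sg y)^-1 * sg x | x : X, y : X].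

Definition Dprime_group := <<sigma_quots>>%G.

Lemma norm_Dprime p : sigma_aut p -> p \in 'N(Dprime_group).
Proof.
move=> pA; apply: (subsetP (norm_gen sigma_quots)); rewrite inE; apply/subsetP.
move=> _ /imsetP[_ /imset2P[x y _ _ ->] ->].
by rewrite conjMg conjVg -!pA; apply: imset2_f.
Qed.

(** The permutations by which the pairs act; as [lamD] normalises [Dprime], the join is a product of
    the two factors. *)
Definition DD_group := (Dprime_group <*> lamD_group)%G.

Lemma lamD_norm_Dprime : lamD \subset 'N(Dprime_group).
Proof. by apply/subsetP=> _ /lamDP[w _ <-]; apply/norm_Dprime/Lam_aut. Qed.

Lemma norm_DD_lam x : lam x \in 'N(DD_group).
Proof.
rewrite -sub1set; apply: normsY; rewrite sub1set; last exact: norm_lamD.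
exact/norm_Dprime/lam_aut.
Qed.

Lemma sg_Dprime x y : (sg y)^-1 * sg x \in DD_group.
Proof.
apply: (subsetP (joing_subl _ _)); apply: mem_gen; exact: imset2_f.
Qed.

Lemma norm_DD_sg x : sg x \in 'N(DD_group).
Proof.
rewrite inE /= {1}norm_joinEr ?lamD_norm_Dprime //.
apply/subsetP=> _ /imsetP[_ /mulsgP[s p Ds Pp ->] ->].
rewrite conjMg groupM //.
  apply: (subsetP (joing_subl _ _)).
  by rewrite memJ_norm //; apply/norm_Dprime/sg_aut.
(* As [p] is a rack automorphism, conjugating it by [sg x] multiplies it by a generator of
   [Dprime]. *)
have -> : p ^ sg x = p * ((sg (p x))^-1 * sg x).
  case/lamDP: (Pp) => w _ <-.
  by rewrite (Lam_aut w) !conjgE !invMg !invgK !mulgA mulgV mul1g.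
by rewrite groupM ?sg_Dprime //; apply: (subsetP (joing_subr _ _)).
Qed.

Definition DD_orbit (x : X) := orbit 'P DD_group x.

Lemma DD_orbitP x y : DD_orbit x = DD_orbit y <-> exists2 q, q \in DD_group & x = q y.
Proof.
split=> [/orbit_eqP/orbitP[q Qq <-]|[q Qq ->]]; first by exists q.
by apply/orbit_eqP/orbitP; exists q.
Qed.

Lemma DD_orbit_pres p : p \in 'N(DD_group) -> pres DD_orbit p.
Proof.
move=> Np x y /DD_orbitP[q Qq ->]; apply/DD_orbitP; exists (q ^ p); first by rewrite memJ_norm.
by rewrite !permM permK.
Qed.

(** The quotients of any two λ's and of any two σ's lie in the group, so all letters act alike on
    orbits. *)
Lemma DD_orbit_const x y :
  peq DD_orbit (lam x) (lam y) /\ peq DD_orbit (sg x) (sg y).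
Proof.
split=> z; apply/DD_orbitP.
  exists ((lam y)^-1 * lam x); last by rewrite permM permK.
  by apply: (subsetP (joing_subr _ _)); apply: lam_lamD.
by exists ((sg y)^-1 * sg x); [apply: sg_Dprime | rewrite permM permK].
Qed.

Lemma ls_congr_DD_orbit : ls_congr DD_orbit.
Proof.
split=> [x|]; first exact/DD_orbit_pres/norm_DD_lam.
by split=> [x|x y _]; [apply/DD_orbit_pres/norm_DD_sg | apply: DD_orbit_const].
Qed.

Lemma DD_transitive_of_orbit : (forall x y, DD_orbit x = DD_orbit y) ->
  DD_transitive lam rho.
Proof.
move=> Hxy x y; have /DD_orbitP[q] := Hxy y x.
(* Products of permutations act from left to right, so the λ factor must come first to obtain
   [s (Lam w x)]. *)
rewrite /= norm_joinEr ?lamD_norm_Dprime // -normC ?lamD_norm_Dprime //.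
move=> /mulsgP[_ s /lamDP[w bw <-] Ds ->] ->.
by exists s, w; rewrite permM; split=> //; split=> //; apply: balanced_Dset.
Qed.

Lemma DD_orbit_inj_lyubashenko : injective DD_orbit -> lyubashenko lam rho.
Proof.
move=> inj x y; apply: gam1_lam_rho; have [Hl Hs] := DD_orbit_const x y.
by apply/gam_eqP; rewrite !Lam1 !Sig1; split; apply/permP=> z; apply: inj.
Qed.

(** Each equality is the first or third braid equation written for [x] and for [y]; the remaining
    permutation is bijective and is cancelled or substituted away. *)
Lemma ls_congr_retraction : ls_congr (fun x => (lam x, rho x)).
Proof.
apply: congr_homo => x y [eql eqr] z.
  rewrite eql; split=> //; congr (_, _); apply/permP=> t.
    have [B1 _ _] := braidE z x ((lam (rho x z))^-1 t).
    have [B1' _ _] := braidE z y ((lam (rho x z))^-1 t).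
    by move: B1 B1'; rewrite eql -eqr permKV => -> .
  have [_ _ B3] := braidE t z x; have [_ _ B3'] := braidE t z y.
  by apply: (@perm_inj _ (rho (rho x z))); rewrite -B3 eqr -B3'.
rewrite eqr; split=> //; congr (_, _); apply/permP=> t.
  have [B1 _ _] := braidE x z t; have [B1' _ _] := braidE y z t.
  by apply: (@perm_inj _ (lam (lam x z))); rewrite -B1 eql -B1'.
have [_ _ B3] := braidE ((rho (lam x z))^-1 t) x z.
have [_ _ B3'] := braidE ((rho (lam x z))^-1 t) y z.
by move: B3 B3'; rewrite eqr -eql permKV => ->.
Qed.

End Solution.

Theorem theorem3p2 (X : finType) (lam rho : X -> {perm X}) :
  braided (rsol lam rho) -> bijective (rsol lam rho) ->
  1 < #|X| -> ~ lyubashenko lam rho ->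
  (simple_sol lam rho <->
     [/\ irretractable lam rho,
         nonzero lam rho (Dset lam rho) /\
           (forall I, ideal lam rho I -> nonzero lam rho I ->
              forall g, Dset lam rho g -> I g)
       & DD_transitive lam rho]).
Proof.
move=> braid /bij_inj rinj cardX nlyu.
have dich := simple_dichotomy braid rinj.
split=> [simpleX|[irr [_ Dmin] tr]].
  have irr : irretractable lam rho.
    case: (dich _ _ simpleX (ls_congr_retraction braid rinj)) => // H.
    by case: nlyu => x y; case: (H x y).
  split=> //; last first.
    case: (dich _ _ simpleX (ls_congr_DD_orbit braid rinj)) => [/DD_orbit_inj_lyubashenko|].
      by move=> H; case: nlyu; apply: H.
    exact: DD_transitive_of_orbit.
  split=> [|I idI [g [Ig nzg]]].
    (* For distinct letters, x - y is a non-zero element of D by irretractability. *)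
    case/card_gt1P: cardX => x [y [_ _ /eqP neq]].
    exists (gam lam rho ([:: x] ++ aneg lam [:: y])); split; first exact: Dset_gen.
    move=> /(gam_sub_eq0 braid rinj)/(gam1_lam_rho braid rinj)[eql eqr].
    by apply/neq/irr; rewrite eql eqr.
  case: (dich _ _ simpleX (ls_congr_iclass braid rinj idI)) => [inj|H].
    case: nzg; case: (idI) => -[/(_ _ Ig)[w Hw] _] _; rewrite -Hw in Ig *.
    exact: ideal_zero_of_iclass_inj inj _ Ig.
  exact: Dset_sub_ideal H.
split=> // Y s f [_ brs] surj fmor.
(* Being a morphism, [f] has values at [lam x y] and [rho y x] that depend on [f x] and [f y] alone,
   so [f] is a congruence. *)
have El x y : f (lam x y) = (s (f x, f y)).1 by rewrite -(fmor (x, y)).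
have Er x y : f (rho y x) = (s (f x, f y)).2 by rewrite -(fmor (x, y)).
have cf : ls_congr lam rho f.
  by apply: congr_homo => // x y eqxy z; rewrite ?El ?Er eqxy.
have [nz|triv] := EM (nonzero lam rho (kernel_ideal lam rho f)).
  right=> y y'; have [[x <-] [x' <-]] := (surj y, surj y').
  apply: kernel_contains_D_const tr x x' => //.
  by apply: Dmin => //; apply: ideal_kernel.
left; have inj := kernel_trivial_inj braid rinj cf irr triv.
have [g gK] := choice surj; exists g => // x.
by apply: inj; rewrite gK.
Qed.
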